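(* Let $\mu \ne 0$, let $\tau_L(\varepsilon),\delta_L(\varepsilon),\tau_R(\varepsilon),\delta_R(\varepsilon)$ vary smoothly with a real parameter $\varepsilon$ near $0$, let $\mathcal{X},\mathcal{Y}$ be words on $\{L,R\}$ with $\mathcal{X}$ primitive and $\mathcal{X}_0 \ne \mathcal{Y}_0$, and let $\mathcal{S}[k]=\mathcal{X}^k\mathcal{Y}$. Suppose that when $\varepsilon=0$: (a) there exist infinitely many $k\ge 1$ for which the border-collision normal form has a unique, admissible, stable $\mathcal{S}[k]$-cycle that has no points on the switching manifold; (b) the eigenvalues of $M_{\mathcal{X}}(0)$ satisfy $0\le\lambda_1(0)<1<\lambda_2(0)$, and the eigenvector $\zeta_2(0)$ corresponding to $\lambda_2(0)$ is not a scalar multiple of $[0,1]^{\sf T}$. Suppose $\gamma_{22}'(0)\ne0$. Then there exist $\varepsilon^*>0$ and $k_{\rm min}\in\mathbb{Z}$ such that for all $k\ge k_{\rm min}$ and all $\varepsilon$ with $$\frac{3}{|\gamma_{22}'(0)|}\,\lambda_2^{-k}(0)\le\varepsilon\le\varepsilon^*,$$ if the $\mathcal{S}[k]$-cycle is admissible with no points on the switching manifold, then it is unstable.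
   Context: For real $\tau_L,\delta_L,\tau_R,\delta_R,\mu$ set $A_J=\begin{bmatrix}\tau_J&1\\ -\delta_J&0\end{bmatrix}$ and $f^J(x,y)=A_J\begin{bmatrix}x\\ y\end{bmatrix}+\begin{bmatrix}\mu\\ 0\end{bmatrix}$ for $J\in\{L,R\}$. The border-collision normal form is the continuous map of $\mathbb{R}^2$ equal to $f^L$ for $x\le0$ and $f^R$ for $x\ge0$; the switching manifold is $x=0$. A word $\mathcal{S}=\mathcal{S}_0\cdots\mathcal{S}_{n-1}$ on $\{L,R\}$ is primitive if it is not a power of a shorter word; primitive words are identified with periodic symbol sequences of minimal period $n$. $\mathcal{X}^k\mathcal{Y}$ denotes concatenation of $k$ copies of $\mathcal{X}$ followed by $\mathcal{Y}$. Put $f^{\mathcal{S}}=f^{\mathcal{S}_{n-1}}\circ\cdots\circ f^{\mathcal{S}_0}$, an affine map with matrix part $M_{\mathcal{S}}=A_{\mathcal{S}_{n-1}}\cdots A_{\mathcal{S}_0}$. An $\mathcal{S}$-cycle consists of points $(x_i^{\mathcal{S}},y_i^{\mathcal{S}})$, $i=0,\dots,n-1$, with $(x_0^{\mathcal{S}},y_0^{\mathcal{S}})$ a fixed point of $f^{\mathcal{S}}$ and $(x_{i+1}^{\mathcal{S}},y_{i+1}^{\mathcal{S}})=f^{\mathcal{S}_i}(x_i^{\mathcal{S}},y_i^{\mathcal{S}})$. It is unique if and only if $1$ is not an eigenvalue of $M_{\mathcal{S}}$. It is admissible if $x_i^{\mathcal{S}}\le0$ whenever $\mathcal{S}_i=L$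 and $x_i^{\mathcal{S}}\ge0$ whenever $\mathcal{S}_i=R$. It has no points on the switching manifold if $x_i^{\mathcal{S}}\neq0$ for all $i$. An admissible $\mathcal{S}$-cycle with no points on the switching manifold is stable if both eigenvalues of $M_{\mathcal{S}}$ have modulus $\le1$, and unstable otherwise. When the parameters depend on $\varepsilon$, so do all these objects. Let $\lambda_1(\varepsilon),\lambda_2(\varepsilon)$ be the eigenvalues of $M_{\mathcal{X}}(\varepsilon)$ (distinct and not equal to $1$ near $\varepsilon=0$ under the stated hypotheses, so the $\mathcal{X}$-cycle is unique), with corresponding eigenvectors $\zeta_1(\varepsilon),\zeta_2(\varepsilon)$ varying smoothly with $\varepsilon$, and $Q(\varepsilon)=[\zeta_1(\varepsilon),\zeta_2(\varepsilon)]$. In the coordinates $\begin{bmatrix}u\\ v\end{bmatrix}=Q^{-1}(\varepsilon)\left(\begin{bmatrix}x\\ y\end{bmatrix}-\begin{bmatrix}x_0^{\mathcal{X}}(\varepsilon)\\ y_0^{\mathcal{X}}(\varepsilon)\end{bmatrix}\right)$, the map $f^{\mathcal{X}}$ becomes $w\mapsto\mathrm{diag}(\lambda_1(\varepsilon),\lambda_2(\varepsilon))\,w$, and $f^{\mathcal{Y}}$ becomes $w\mapsto\begin{bmatrix}\gamma_{11}(\varepsilon)&\gamma_{12}(\varepsilon)\\ \gamma_{21}(\varepsilon)&\gamma_{22}(\varepsilon)\end{bmatrix}w+\begin{bmatrix}\sigma_1(\varepsilon)\\ \sigma_2(\varepsilon)\end{bmatrix}$, which defines $\gamma_{ij}$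 and $\sigma_i$. Primes denote $d/d\varepsilon$. *)

(* Defs.v *)
From HB Require Import structures.
From mathcomp Require Import all_boot all_order all_algebra.
From mathcomp Require Import complex.
From mathcomp Require Import all_classical all_reals all_analysis.
Import Order.TTheory GRing.Theory Num.Theory.
Import numFieldNormedType.Exports.

Set Implicit Arguments.
Unset Strict Implicit.
Unset Printing Implicit Defensive.

Local Open Scope classical_set_scope.
Local Open Scope ring_scope.

Inductive letter := SymL | SymR.

Definition word := seq letter.

Definition word_pow (k : nat) (W : word) : word := flatten (nseq k W).

(* The default value of [head] is irrelevant: it is only used on nonempty
   words. *)
Definition first_letter (W : word) : letter := head SymL W.

Definition primitive (W : word) : Prop :=
  (0 < size W)%N /\
  forall (V : word) (m : nat), (size V < size W)%N -> W <> word_pow m V.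

Section BorderCollisionNormalForm.
Variable R : realType.

Record bcnf := Bcnf {
  tauL : R; deltaL : R;
  tauR : R; deltaR : R;
  mu : R }.

Definition tau (p : bcnf) (J : letter) : R :=
  if J is SymL then tauL p else tauR p.

Definition delta (p : bcnf) (J : letter) : R :=
  if J is SymL then deltaL p else deltaR p.

(* [[tau, 1], [- delta, 0]] *)
Definition A_ (p : bcnf) (J : letter) : 'M[R]_2 :=
  \matrix_(i, j)
    if i == 0 then (if j == 0 then tau p J else 1)
    else (if j == 0 then - delta p J else 0).

Definition col2 (x y : R) : 'cV[R]_2 := \col_i (if i == 0 then x else y).

Definition xcoord (z : 'cV[R]_2) : R := z 0 0.

Definition f_ (p : bcnf) (J : letter) (z : 'cV[R]_2) : 'cV[R]_2 :=
  A_ p J *m z + col2 (mu p) 0.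

(* The first letter of the word acts first. *)
Definition f_word (p : bcnf) (S : word) (z : 'cV[R]_2) : 'cV[R]_2 :=
  foldl (fun w J => f_ p J w) z S.

Definition M_word (p : bcnf) (S : word) : 'M[R]_2 :=
  foldl (fun M J => A_ p J *m M) 1%:M S.

(* A cycle is the list of its points z_0, ..., z_(n-1), n = size S. *)
Definition is_cycle (p : bcnf) (S : word) (z : seq 'cV[R]_2) : Prop :=
  [/\ size z = size S,
      f_word p S (nth 0 z 0) = nth 0 z 0 &
      forall i, (i.+1 < size S)%N ->
        nth 0 z i.+1 = f_ p (nth SymL S i) (nth 0 z i)].

Definition has_unique_cycle (p : bcnf) (S : word) : Prop :=
  exists! z, is_cycle p S z.

Definition admissible (S : word) (z : seq 'cV[R]_2) : Prop :=
  forall i, (i < size S)%N ->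
    match nth SymL S i with
    | SymL => xcoord (nth 0 z i) <= 0
    | SymR => 0 <= xcoord (nth 0 z i)
    end.

Definition off_switching_manifold (S : word) (z : seq 'cV[R]_2) : Prop :=
  forall i, (i < size S)%N -> xcoord (nth 0 z i) != 0.

(* Stability of an S-cycle that is admissible and has no points on the
   switching manifold; it depends only on M_S. The eigenvalues are complex. *)
Definition stable (p : bcnf) (S : word) : Prop :=
  forall l : R[i],
    eigenvalue (map_mx (real_complex R) (M_word p S)) l -> `|l| <= 1.

Definition unstable (p : bcnf) (S : word) : Prop := ~ stable p S.

(* [eigenvalue] in the library refers to row vectors; eigenvectors here are
   column vectors. *)
Definition eigenpair (M : 'M[R]_2) (l : R) (z : 'cV[R]_2) : Prop :=
  z != 0 /\ M *m z = l *: z.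

Definition smooth_near0 (g : R -> R) : Prop :=
  \forall e \near (0 : R), forall n : nat, derivable (derive1n n g) e 1.

Definition smooth_near0_vec (z : R -> 'cV[R]_2) : Prop :=
  forall i, smooth_near0 (fun e => z e i 0).

Definition columns (z1 z2 : 'cV[R]_2) : 'M[R]_2 := row_mx z1 z2.

Definition to_coords (Q : 'M[R]_2) (z0 z : 'cV[R]_2) : 'cV[R]_2 :=
  invmx Q *m (z - z0).

(* In the coordinates w = Q^-1 (z - z0), the map g is w |-> G w + s. *)
Definition becomes_affine (Q : 'M[R]_2) (z0 : 'cV[R]_2)
    (g : 'cV[R]_2 -> 'cV[R]_2) (G : 'M[R]_2) (s : 'cV[R]_2) : Prop :=
  forall z, to_coords Q z0 (g z) = G *m to_coords Q z0 z + s.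

End BorderCollisionNormalForm.

(* Main.v *)
(* The trace of the matrix of X^k Y is gamma11 * lambda1^k + gamma22 * lambda2^k,
   and stability forces it to be at most 2 in absolute value.  Letting k grow in
   hypothesis (a) gives gamma22 = 0 at e = 0.  Hence gamma22 e ~ gamma22'(0) * e,
   while lambda2 e >= lambda2 0 * (1 - c * e) because lambda2 is differentiable
   at 0, so for e >= 3 / |gamma22'(0)| * lambda2 0 ^- k the second term of the
   trace is at least 5/2 and the first is below 1/2. *)
Require Import Defs.
From mathcomp Require Import all_boot all_order all_algebra.
From mathcomp Require Import complex.
From mathcomp Require Import all_classical all_reals all_analysis.
From mathcomp Require Import ring lra.
Import Order.TTheory GRing.Theory Num.Theory.
Import numFieldNormedType.Exports.

Local Open Scope classical_set_scope.
Local Open Scope ring_scope.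

(** * Growth of exponentials, and the trace bound from stability *)

Lemma ler_bernoulli (R : realDomainType) (x : R) (k : nat) :
  -1 <= x -> 1 + k%:R * x <= (1 + x) ^+ k.
Proof.
move=> x1; elim: k => [|k IHk]; first by rewrite mul0r addr0 expr0.
rewrite exprS; apply: le_trans (ler_wpM2l _ IHk); last by lra.
have := mulr_ge0 (ler0n R k) (sqr_ge0 x).
rewrite -natr1 expr2; lra.
Qed.

Lemma exp_unbounded (R : realType) (l c B : R) : 1 < l -> 0 < c ->
  exists N : nat, forall k : nat, (N <= k)%N -> B < c * l ^+ k.
Proof.
move=> l1 c0; have t0 : 0 < l - 1 by rewrite subr_gt0.
have ct0 : 0 < c * (l - 1) by rewrite mulr_gt0.
exists (Num.bound `|B / (c * (l - 1))|) => k Nk.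
have h : B / (c * (l - 1)) < k%:R.
  apply: le_lt_trans (ler_norm _) _; apply: lt_le_trans (archi_boundP (normr_ge0 _)) _.
  by rewrite ler_nat.
move: h; rewrite ltr_pdivrMr// => h.
have := @ler_bernoulli R (l - 1) k; rewrite subrKC => /(_ ltac:(lra)) b.
have := ler_pM2l c0 (1 + k%:R * (l - 1)) (l ^+ k); rewrite b; lra.
Qed.

(* Squaring Bernoulli's inequality for [Num.sqrt l] gives quadratic growth. *)
Lemma exp_superlinear (R : realType) (l c : R) : 1 < l -> 0 < c ->
  exists N : nat, forall k : nat, (N <= k)%N -> k%:R <= c * l ^+ k.
Proof.
move=> l1 c0; pose u := Num.sqrt l.
have u1 : 1 < u by rewrite -sqrtr1 ltr_sqrt//; lra.
have [N hN] := @exp_unbounded R u (c * (u - 1)) 1 u1 ltac:(nra).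
exists N => k /hN h.
have -> : l = u ^+ 2 by rewrite sqr_sqrtr//; lra.
rewrite -exprM mulnC exprM expr2.
have := @ler_bernoulli R (u - 1) k; rewrite subrKC => /(_ ltac:(lra)) b.
have k0 : 0 <= k%:R :> R by [].
set U := u ^+ k in h b *.
(* One factor [U] is bounded below by [k * (u - 1)]; the other makes [c * (u - 1) * U] exceed 1. *)
have U0 : 0 < U by rewrite exprn_gt0//; lra.
have h1 : c * (U * U) = (c * U) * U by ring.
have h2 : (c * U) * (k%:R * (u - 1)) <= c * U * U.
  by rewrite ler_wpM2l//; nra.
have h3 : (c * U) * (k%:R * (u - 1)) = (c * (u - 1) * U) * k%:R by ring.
rewrite h1; apply: le_trans h2; rewrite h3; nra.
Qed.

(** Over the complex numbers the characteristic polynomial splits with roots [a] and [b]. Comparing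
    coefficients of degree 1 gives the real trace as [Re a + Re b], and each real part is at most 1
    in absolute value. *)
Lemma norm_trace_stable (R : realType) (p : bcnf R) (W : word) :
  stable p W -> `|\tr (M_word p W)| <= 2.
Proof.
rewrite /stable; set M := M_word p W; set MC := map_mx _ M => st.
have [rs rsE] := closed_field_poly_normal (char_poly MC).
have mon : lead_coef (char_poly MC) = 1 by apply/monicP; exact: char_poly_monic.
move: rsE; rewrite mon scale1r => rsE.
have : size rs = 2%N.
  by move: (size_char_poly MC); rewrite rsE size_prod_XsubC => -[].
case: rs rsE => [//|a [//|b [|//]]] rsE _.
have evn z : z \in [:: a; b] -> `|complex.Re z| <= 1.
  move=> zab; have : `|z| <= 1.
    apply: st.
    by rewrite eigenvalue_root_char rsE root_prod_XsubC.
  move=> z1; have := le_trans (normc_ge_Re z) z1; rewrite (_ : 1 = 1%:C%C)// lecR; exact.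
have := char_poly_trace MC isT.
rewrite rsE big_cons big_seq1 mulrBl !mulrBr -polyCM.
rewrite /= !(coefB, coefMX, coefMC, coefCM, coefX, coefC) /=.
rewrite trace_map_mx => h.
have -> : \tr M = complex.Re a + complex.Re b.
  move: h; rewrite !mul1r subr0 sub0r -opprD => /oppr_inj /(congr1 (@complex.Re R)) /=.
  by rewrite addrC raddfD.
apply: le_trans (ler_normD _ _) _.
have := evn a; have := evn b; rewrite !inE !eqxx orbT => /(_ isT) ? /(_ isT) ?.
lra.
Qed.

(* Near the left end of the range of [e] Bernoulli's inequality makes
   [(1 - c * e) ^+ k] close to 1; as soon as [k * c * e > 1 / 12] the
   exponential growth of [l ^+ k] alone suffices. *)
Lemma unstable_growth (R : realType) (g L c : R) : 0 < g -> 1 < L -> 0 < c ->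
  exists d : R, 0 < d /\ exists N : nat, forall (k : nat) (e l : R), (N <= k)%N ->
    3 / g * L ^- k <= e -> e <= d -> L * (1 - c * e) <= l ->
    5 / 2 <= 11 / 12 * g * e * l ^+ k.
Proof.
move=> g0 L1 c0; have L0 : 0 < L by lra.
have s1 : 1 < (1 + L) / 2 by lra.
set s := _ / 2 in s1.
(* This constant serves the case [k * c * e > 1 / 12]: multiplying [360 * c * k <= 11 * g * s ^+ k]
   by [e] gives [30 < 11 * g * e * s ^+ k], and 30 / 12 is 5 / 2. *)
have c'0 : 0 < 11 * g / (360 * c) by rewrite divr_gt0; lra.
have [N hN] := @exp_superlinear R s _ s1 c'0.
(* For [e] up to this bound, [L * c * e <= (L - 1) / 2], so [L * (1 - c * e)] is at least the
   midpoint [s] of 1 and [L]. *)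
exists ((L - 1) / (2 * L * c)); split.
  by rewrite divr_gt0 ?subr_gt0// !mulr_gt0.
exists N => k e l /hN Nk elo ehi ll.
have Lk0 : 0 < L ^+ k by rewrite exprn_gt0.
have e0 : 0 < e.
  by apply: lt_le_trans elo; rewrite mulr_gt0 ?invr_gt0// divr_gt0.
have sl : s <= L * (1 - c * e).
  move: ehi; rewrite ler_pdivlMr ?mulr_gt0// => ehi.
  rewrite /s; lra.
have t0 : 0 < 1 - c * e by rewrite -(pmulr_rgt0 _ L0); lra.
have gLe : 3 <= g * e * L ^+ k.
  have : 3 / g * L ^- k * (g * L ^+ k) <= e * (g * L ^+ k).
    by rewrite ler_wpM2r// mulr_ge0// ltW.
  rewrite (_ : 3 / g * L ^- k * (g * L ^+ k) = 3); last by field; lra.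
  by rewrite (_ : e * _ = g * e * L ^+ k)//; ring.
have k0 : 0 <= k%:R :> R by [].
have [kce|kce] := leP (k%:R * (c * e)) (1 / 12).
  have lk : (L * (1 - c * e)) ^+ k <= l ^+ k by rewrite lerXn2r ?nnegrE//; nra.
  have tk : 1 - 1 / 12 <= (1 - c * e) ^+ k.
    have := @ler_bernoulli R (- (c * e)) k; rewrite mulrN => /(_ ltac:(lra)) h.
    by apply: le_trans h; lra.
  have gek : g * e * (L ^+ k * (1 - c * e) ^+ k) <= g * e * l ^+ k.
    by rewrite ler_wpM2l -?exprMn// mulr_ge0// ltW.
  (* The constant 3 leaves just enough room: 3 times the square of 11 / 12 is 363 / 144, slightly
     above 5 / 2. *)
  have : 3 * (11 / 12) <= (g * e * L ^+ k) * (1 - c * e) ^+ k.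
    by rewrite ler_pM//; lra.
  lra.
have lk : s ^+ k <= l ^+ k by rewrite lerXn2r ?nnegrE//; lra.
have gek : g * e * s ^+ k <= g * e * l ^+ k.
  by rewrite ler_wpM2l// mulr_ge0// ltW.
have h : k%:R * (360 * c) <= 11 * g * s ^+ k.
  by move: Nk; rewrite mulrAC ler_pdivlMr; lra.
have := ler_wpM2l (ltW e0) h; lra.
Qed.

(** If [a] were nonzero, exponential growth would confine [K] to an initial segment. *)
Lemma bounded_mul_exp_eq0 (R : realType) (a b l : R) (K : set nat) :
  1 < l -> infinite_set K -> (forall k, K k -> `|a| * l ^+ k <= b) -> a = 0.
Proof.
move=> l1 Kinf aK; apply/eqP; apply: contra_notT Kinf => a0.
have [N hN] := @exp_unbounded R l `|a| b l1 ltac:(by rewrite normr_gt0).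
apply: (@sub_finite_set _ _ `I_N) => [k Kk /=|]; last exact: finite_II.
by rewrite ltnNge; apply/negP => /hN; rewrite ltNge aK.
Qed.

(** * Matrices of words, eigenbases and the trace formula *)

Section Words.
Context {R : realType}.
Implicit Types (p : bcnf R) (W V : word) (Q : 'M[R]_2).

Lemma M_word_rcons p W J : M_word p (rcons W J) = A_ p J *m M_word p W.
Proof. exact: foldl_rcons. Qed.

Lemma M_word_cat p W V : M_word p (W ++ V) = M_word p V *m M_word p W.
Proof.
elim/last_ind: V => [|V J IHV]; first by rewrite cats0 mul1mx.
by rewrite -rcons_cat !M_word_rcons IHV mulmxA.
Qed.

Lemma f_word_affine p W z : f_word p W z = M_word p W *m z + f_word p W 0.
Proof.
elim/last_ind: W => [|W J IHW]; first by rewrite mul1mx addr0.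
rewrite M_word_rcons /f_word !foldl_rcons -!/(f_word p W _) IHW /f_.
by rewrite mulmxDr addrA mulmxA.
Qed.

(** Evaluating at [z0] determines [s]; evaluating at [z0] plus column [j] of [Q] and cancelling the
    translation leaves column [j] of the identity. *)
Lemma becomes_affine_conj p W Q z0 (G : 'M[R]_2) s :
  Q \in unitmx -> becomes_affine Q z0 (f_word p W) G s ->
  Q *m G = M_word p W *m Q.
Proof.
move=> Qu aff.
have aff0 := aff z0.
rewrite /to_coords subrr mulmx0 mulmx0 add0r in aff0.
apply/matrixP => i j; have := aff (z0 + Q *m delta_mx j 0).
rewrite -{}aff0 /to_coords f_word_affine [in f_word p W z0]f_word_affine.
rewrite [z0 + _]addrC addrK mulKmx// => /(congr1 (mulmx Q)).
rewrite mulmxDr !mulKVmx// mulmxDr -!addrA => /addIr.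
by rewrite !mulmxA -!colE => /matrixP/(_ i 0); rewrite !mxE => ->.
Qed.

Lemma columns0 (z1 z2 : 'cV[R]_2) i : columns z1 z2 i 0 = z1 i 0.
Proof.
by rewrite -[RHS](row_mxEl z1 z2); congr (row_mx _ _ _ _); apply/val_inj.
Qed.

Lemma columns1 (z1 z2 : 'cV[R]_2) i : columns z1 z2 i 1 = z2 i 0.
Proof.
by rewrite -[RHS](row_mxEr z1 z2); congr (row_mx _ _ _ _); apply/val_inj.
Qed.

(** The determinant of [columns z1 z2]. *)
Definition cross (z1 z2 : 'cV[R]_2) : R := z1 0 0 * z2 1 0 - z1 1 0 * z2 0 0.

Lemma mulmx2E m n (A : 'M[R]_(m, 2)) (B : 'M[R]_(2, n)) i j :
  (A *m B) i j = A i 0 * B 0 j + A i 1 * B 1 j.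
Proof.
by rewrite mxE big_ord_recl big_ord1; congr (_ + A i _ * B _ j); apply/val_inj.
Qed.

Lemma ord2P (P : 'I_2 -> Prop) : P 0 -> P 1 -> forall i, P i.
Proof.
by move=> P0 P1 [[|[|//]] lti];
  [rewrite (_ : Ordinal lti = 0) | rewrite (_ : Ordinal lti = 1)];
  rewrite //; apply/val_inj.
Qed.

(** By the eigenvector equations, [l1 - l2] times a product of a coordinate of [z1] and one of [z2]
    is a multiple of [cross z1 z2]. If the latter vanishes, so do all four products, and one of the
    vectors is zero. *)
Lemma eigenpair_cross_neq0 (M : 'M[R]_2) l1 l2 z1 z2 :
  l1 != l2 -> eigenpair M l1 z1 -> eigenpair M l2 z2 -> cross z1 z2 != 0.
Proof.
move=> l12 [z1n e1] [z2n e2]; apply/eqP => c0.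
have mul0 x t : (l1 - l2) * x = t * cross z1 z2 -> x = 0.
  move/eqP; rewrite c0 mulr0 mulf_eq0 subr_eq0 (negPf l12) => /eqP//.
move/matrixP: e1 => e1; move/matrixP: e2 => e2.
have := e1 0 0; have := e1 1 0; have := e2 0 0; have := e2 1 0.
rewrite !mulmx2E !mxE => d2 b2 c1 a1.
have ab : z1 0 0 * z2 0 0 = 0.
  apply: (mul0 _ (- M 0 1)); rewrite /cross.
  have -> : (l1 - l2) * (z1 0 0 * z2 0 0) =
    z2 0 0 * (l1 * z1 0 0) - z1 0 0 * (l2 * z2 0 0) by ring.
  rewrite -a1 -b2; ring.
have cd : z1 1 0 * z2 1 0 = 0.
  apply: (mul0 _ (M 1 0)); rewrite /cross.
  have -> : (l1 - l2) * (z1 1 0 * z2 1 0) =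
    z2 1 0 * (l1 * z1 1 0) - z1 1 0 * (l2 * z2 1 0) by ring.
  rewrite -c1 -d2; ring.
have ad : z1 0 0 * z2 1 0 = 0.
  apply: (mul0 _ (l1 - M 1 1)); rewrite /cross.
  have -> : (l1 - l2) * (z1 0 0 * z2 1 0) =
    l1 * (z1 0 0 * z2 1 0 - z1 1 0 * z2 0 0) +
    z2 0 0 * (l1 * z1 1 0) - z1 0 0 * (l2 * z2 1 0) by ring.
  rewrite -c1 -d2; ring.
have cb : z1 1 0 * z2 0 0 = 0.
  by move: c0; rewrite /cross ad sub0r => /eqP; rewrite oppr_eq0 => /eqP.
have [a0|an] := eqVneq (z1 0 0) 0.
  have [c00|cn] := eqVneq (z1 1 0) 0.
    by case/eqP: z1n; apply/matrixP; apply: ord2P => j; rewrite ord1 mxE.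
  by case/eqP: z2n; apply/matrixP; apply: ord2P => j; rewrite ord1 mxE;
    apply: (mulfI cn); rewrite mulr0.
by case/eqP: z2n; apply/matrixP; apply: ord2P => j; rewrite ord1 mxE;
  apply: (mulfI an); rewrite mulr0.
Qed.

Lemma columns_unitmx (z1 z2 : 'cV[R]_2) :
  cross z1 z2 != 0 -> columns z1 z2 \in unitmx.
Proof.
(* [B] is the adjugate divided by the determinant. *)
move=> c0; pose B : 'M[R]_2 := \matrix_(i, j) ((cross z1 z2)^-1 *
  (if i == 0 then if j == 0 then z2 1 0 else - z2 0 0
   else if j == 0 then - z1 1 0 else z1 0 0)).
suff : B *m columns z1 z2 = 1%:M by case/mulmx1_unit.
apply/matrixP; apply: ord2P; apply: ord2P;
  rewrite mulmx2E ?columns0 ?columns1 !mxE /=; move: c0; rewrite /cross => c0;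
  by field.
Qed.

(** Cramer's rule for the diagonal of [G]. It expresses these entries through the eigenvectors and
    [M], whose dependence on the parameter is known to be smooth. *)
Lemma columns_conj (M G : 'M[R]_2) (z1 z2 : 'cV[R]_2) :
  columns z1 z2 *m G = M *m columns z1 z2 ->
  G 0 0 * cross z1 z2 = cross (M *m z1) z2 /\
  G 1 1 * cross z1 z2 = cross z1 (M *m z2).
Proof.
move=> /matrixP h; have := h 0 0; have := h 0 1; have := h 1 0; have := h 1 1.
rewrite /cross !mulmx2E !columns0 !columns1 => <- <- <- <-.
by split; ring.
Qed.

(** In the eigenbasis the matrix of [word_pow k X] is the diagonal [D k]; cyclicity of the trace
    moves the change of basis onto the matrix of [Y], leaving the trace of [G *m D k]. *)
Lemma trace_pow_cat p X Y k l1 l2 z1 z2 (G : 'M[R]_2) :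
  columns z1 z2 \in unitmx ->
  columns z1 z2 *m G = M_word p Y *m columns z1 z2 ->
  eigenpair (M_word p X) l1 z1 -> eigenpair (M_word p X) l2 z2 ->
  \tr (M_word p (word_pow k X ++ Y)) = G 0 0 * l1 ^+ k + G 1 1 * l2 ^+ k.
Proof.
set Q := columns _ _ => Qu GQ [_ e1] [_ e2].
pose D n : 'M[R]_2 := diag_mx (\row_i (if i == 0 then l1 else l2) ^+ n).
have e12 : M_word p X *m Q = Q *m D 1.
  apply/matrixP => i; apply: ord2P; rewrite !mulmx2E ?columns0 ?columns1 !mxE /=.
    by rewrite -mulmx2E e1 !mxE mulr0n mulr1n mulr0 addr0 mulrC.
  by rewrite -mulmx2E e2 !mxE mulr0n mulr1n mulr0 add0r mulrC.
have MQ n : M_word p (word_pow n X) *m Q = Q *m D n.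
  elim: n => [|n IHn].
    rewrite mul1mx (_ : D 0 = 1%:M) ?mulmx1//.
    by apply/matrixP => i j; rewrite !mxE expr0.
  rewrite /word_pow /= M_word_cat -mulmxA e12 mulmxA IHn -mulmxA; congr (_ *m _).
  by rewrite mulmx_diag; congr diag_mx; apply/rowP => i; rewrite !mxE exprSr.
rewrite M_word_cat -[M_word p (word_pow k X)](mulmxK Qu) MQ mulmxA mxtrace_mulC.
rewrite !mulmxA -(mulmxA _ _ Q) -GQ mulmxA mulVmx// mul1mx.
rewrite /mxtrace big_ord_recl big_ord1 (_ : lift _ _ = 1); last exact/val_inj.
by rewrite !mulmx2E !mxE /= !(mulr0n, mulr1n, mulr0, addr0, add0r).
Qed.
End Words.

(** * Differentiability at 0 of eigenvalues and coefficients *)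

Section Derivability.
Context {R : realType}.
Implicit Types (f : R -> R).

Lemma derivable_first_order f : derivable f 0 1 ->
  forall eta : R, 0 < eta ->
  \forall e \near (0 : R), `|f e - f 0 - e * derive1 f 0| <= eta * `|e|.
Proof.
move=> df eta eta0.
have := df; rewrite /derivable => /cvgrPdist_le /(_ eta eta0).
rewrite -[lim _]/('D_1 f 0) -derive1E near_withinE => h.
(* The limit defining the derivative concerns only nonzero [e]; at 0 both sides vanish. *)
near=> e; have [->|en0] := eqVneq e 0.
  by rewrite subrr mul0r subr0 !normr0 mulr0.
have : e != 0 -> `|derive1 f 0 - e^-1 * (f e - f 0)| <= eta.
  near: e; apply: filterS h => h he /he; rewrite /= addr0 [h *: 1]mulr1.
  exact.
move=> /(_ en0); rewrite distrC => he.
rewrite [eta * _]mulrC -ler_pdivrMl ?normr_gt0// -normfV -normrM.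
by rewrite (_ : _ * _ = e^-1 * (f e - f 0) - derive1 f 0)//; field.
Unshelve. all: by end_near. Qed.

Lemma derivable_norm_near f (B : R) : derivable f 0 1 -> `|f 0| < B ->
  \forall e \near (0 : R), `|f e| < B.
Proof.
move=> /derivable1_diffP /differentiable_continuous f0 fB.
have : (fun e => `|f e|) @ (0 : R) --> `|f 0| by exact: cvg_norm.
by move/cvgr_lt; apply.
Qed.

Lemma derivable_neq0_near f : derivable f 0 1 -> f 0 != 0 ->
  \forall e \near (0 : R), f e != 0.
Proof.
move=> /derivable1_diffP /differentiable_continuous f0 fn0.
exact: (cvgr_neq0 _ f0).
Qed.

Lemma derivable_M_word (p : R -> bcnf R) (W : word) :
  derivable (fun e => tauL (p e)) 0 1 -> derivable (fun e => deltaL (p e)) 0 1 ->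
  derivable (fun e => tauR (p e)) 0 1 -> derivable (fun e => deltaR (p e)) 0 1 ->
  forall i j, derivable (fun e => M_word (p e) W i j) 0 1.
Proof.
move=> dtL ddL dtR ddR; elim/last_ind: W => [|W J IHW] i j.
  exact: derivable_cst.
have dA : forall i k, derivable (fun e => A_ (p e) J i k) 0 1.
  apply: ord2P; apply: ord2P; under eq_fun do rewrite mxE /=.
  - by case: J; [exact: dtL | exact: dtR].
  - exact: derivable_cst.
  - by case: J; [exact: derivableN ddL | exact: derivableN ddR].
  - exact: derivable_cst.
under eq_fun do rewrite M_word_rcons mulmx2E.
exact: derivableD (derivableM (dA i 0) (IHW 0 j))
  (derivableM (dA i 1) (IHW 1 j)).
Qed.

Lemma derivable_cross (z1 z2 : R -> 'cV[R]_2) :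
  (forall i, derivable (fun e => z1 e i 0) 0 1) ->
  (forall i, derivable (fun e => z2 e i 0) 0 1) ->
  derivable (fun e => cross (z1 e) (z2 e)) 0 1.
Proof.
move=> d1 d2.
exact: derivableB (derivableM (d1 0) (d2 1)) (derivableM (d1 1) (d2 0)).
Qed.

Lemma derivable_mulmx (M : R -> 'M[R]_2) (z : R -> 'cV[R]_2) :
  (forall i j, derivable (fun e => M e i j) 0 1) ->
  (forall i, derivable (fun e => z e i 0) 0 1) ->
  forall i, derivable (fun e => (M e *m z e) i 0) 0 1.
Proof.
move=> dM dz i; under eq_fun do rewrite mulmx2E.
exact: derivableD (derivableM (dM i 0) (dz 0)) (derivableM (dM i 1) (dz 1)).
Qed.

(** Eigenvalues and diagonal entries of [Gamma] are given by equations near 0; since [b] stays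
    nonzero there, they are quotients of derivable functions. *)
Lemma derivable_div_near f (a b : R -> R) :
  derivable a 0 1 -> derivable b 0 1 -> b 0 != 0 ->
  (\forall e \near (0 : R), f e * b e = a e) -> derivable f 0 1.
Proof.
move=> da db b0 fab.
apply: (@near_eq_derivable _ _ _ (fun e => a e * (b e)^-1)).
  have bn := derivable_neq0_near _ db b0.
  by near=> e; rewrite -(near fab e)// mulfK//; near: e.
exact: derivableM da (derivableV b0 db).
Unshelve. all: by end_near. Qed.

(** A coordinate of the eigenvector that is nonzero at 0 expresses the eigenvalue as a quotient. *)
Lemma derivable_eigenvalue (M : R -> 'M[R]_2) (l : R -> R) (z : R -> 'cV[R]_2) :
  (forall i j, derivable (fun e => M e i j) 0 1) ->
  (forall i, derivable (fun e => z e i 0) 0 1) ->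
  (\forall e \near (0 : R), eigenpair (M e) (l e) (z e)) ->
  derivable l 0 1.
Proof.
move=> dM dz ev; have [z0 _] := nbhs_singleton ev.
have [i zi0] : exists i, z 0 i 0 != 0.
  apply/existsP; apply: contraNT z0 => /existsPn z0.
  apply/eqP/matrixP => i j; rewrite ord1 mxE; apply/eqP.
  by have := z0 i; rewrite negbK.
apply: (@derivable_div_near _ (fun e => (M e *m z e) i 0) (fun e => z e i 0)) => //.
  exact: derivable_mulmx.
by apply: filterS ev => e [_ ->]; rewrite mxE.
Qed.
End Derivability.

(** * Instability of the cycles for small positive parameters *)

Theorem lemma3p2 (R : realType) (mu : R)
    (tauL deltaL tauR deltaR : R -> R) (X Y : word)
    (lambda1 lambda2 : R -> R) (zeta1 zeta2 : R -> 'cV[R]_2)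
    (z0X : R -> 'cV[R]_2)
    (Gamma : R -> 'M[R]_2) (sigma : R -> 'cV[R]_2) :
  let p := fun e : R => Bcnf (tauL e) (deltaL e) (tauR e) (deltaR e) mu in
  let S := fun k : nat => word_pow k X ++ Y in
  let Q := fun e : R => columns (zeta1 e) (zeta2 e) in
  let gamma22 := fun e : R => Gamma e 1 1 in
  mu != 0 ->
  smooth_near0 tauL -> smooth_near0 deltaL ->
  smooth_near0 tauR -> smooth_near0 deltaR ->
  primitive X -> (0 < size Y)%N -> first_letter X <> first_letter Y ->
  smooth_near0_vec zeta1 -> smooth_near0_vec zeta2 ->
  (\forall e \near (0 : R), eigenpair (M_word (p e) X) (lambda1 e) (zeta1 e)) ->
  (\forall e \near (0 : R), eigenpair (M_word (p e) X) (lambda2 e) (zeta2 e)) ->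
  (\forall e \near (0 : R), f_word (p e) X (z0X e) = z0X e) ->
  (\forall e \near (0 : R),
     becomes_affine (Q e) (z0X e) (f_word (p e) Y) (Gamma e) (sigma e)) ->
  infinite_set [set k : nat | (1 <= k)%N /\
    has_unique_cycle (p 0) (S k) /\
    exists z, [/\ is_cycle (p 0) (S k) z, admissible (S k) z,
      off_switching_manifold (S k) z & stable (p 0) (S k)]] ->
  0 <= lambda1 0 -> lambda1 0 < 1 -> 1 < lambda2 0 ->
  ~ (exists c : R, zeta2 0 = c *: col2 0 1) ->
  derive1 gamma22 0 != 0 ->
  exists (estar : R) (kmin : int), 0 < estar /\
    forall (k : nat) (e : R), kmin <= k%:Z ->
      3 / `|derive1 gamma22 0| * lambda2 0 ^- k <= e -> e <= estar ->
      forall z, is_cycle (p e) (S k) z -> admissible (S k) z ->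
        off_switching_manifold (S k) z -> unstable (p e) (S k).
Proof.
move=> p S Q gamma22 _ stL sdL stR sdR _ _ _ sz1 sz2 ev1 ev2 _ aff inf.
move=> l1ge l1lt l2gt _ dg.
have d0 (g : R -> R) : smooth_near0 g -> derivable g 0 1.
  by move=> /nbhs_singleton /(_ 0%N).
have dM W := derivable_M_word p W (d0 _ stL) (d0 _ sdL) (d0 _ stR) (d0 _ sdR).
have dz1 i := d0 _ (sz1 i); have dz2 i := d0 _ (sz2 i).
have dl1 := derivable_eigenvalue _ _ _ (dM X) dz1 ev1.
have dl2 := derivable_eigenvalue _ _ _ (dM X) dz2 ev2.
(* The eigenvalues lie on opposite sides of 1 at 0, so they remain distinct nearby; the eigenvectors
   are then independent and [Q e] is invertible. *)
have l12 : \forall e \near (0 : R), lambda2 e - lambda1 e != 0.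
  by apply: derivable_neq0_near; [exact: derivableB dl2 dl1 | apply/eqP; lra].
have cr : \forall e \near (0 : R), cross (zeta1 e) (zeta2 e) != 0.
  near=> e; apply: (@eigenpair_cross_neq0 _ (M_word (p e) X) (lambda1 e) (lambda2 e)).
  - by rewrite eq_sym -subr_eq0; near: e.
  - by near: e.
  - by near: e.
have conj : \forall e \near (0 : R), Q e *m Gamma e = M_word (p e) Y *m Q e.
  near=> e; apply: (becomes_affine_conj _ _ _ (z0X e) _ (sigma e)); last by near: e.
  by apply: columns_unitmx; near: e.
have dcr := derivable_cross _ _ dz1 dz2.
have dG0 : derivable (fun e => Gamma e 0 0) 0 1.
  apply: derivable_div_near (derivable_cross _ _ (derivable_mulmx _ _ (dM Y) dz1) dz2)
    dcr (nbhs_singleton cr) _.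
  by apply: filterS conj => e /columns_conj[].
have dG1 : derivable gamma22 0 1.
  apply: derivable_div_near (derivable_cross _ _ dz1 (derivable_mulmx _ _ (dM Y) dz2))
    dcr (nbhs_singleton cr) _.
  by apply: filterS conj => e /columns_conj[].
have tr : \forall e \near (0 : R), forall k, \tr (M_word (p e) (S k)) =
    Gamma e 0 0 * lambda1 e ^+ k + gamma22 e * lambda2 e ^+ k.
  near=> e => k; apply: (@trace_pow_cat _ _ _ _ _ _ _ (zeta1 e) (zeta2 e)).
  - by apply: columns_unitmx; near: e.
  - by near: e.
  - by near: e.
  - by near: e.
have g0 : gamma22 0 = 0.
  (* The bound is 2 for the trace plus [|Gamma 0 0 0|] for the first term, as
     [lambda1 0 ^+ k <= 1]. *)
  apply: (bounded_mul_exp_eq0 _ _ (2 + `|Gamma 0 0 0|) _ _ l2gt inf) => k.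
  move=> [_ [_ [z [_ _ _]]]].
  move=> /norm_trace_stable; rewrite (nbhs_singleton tr) => tk.
  have l2k : 0 < lambda2 0 ^+ k by rewrite exprn_gt0//; lra.
  have l1k : `|Gamma 0 0 0 * lambda1 0 ^+ k| <= `|Gamma 0 0 0|.
    rewrite normrM ler_piMr// ger0_norm ?exprn_ge0// exprn_ile1//; exact: ltW.
  rewrite -[X in _ * X]gtr0_norm// -normrM.
  have := ler_normB (Gamma 0 0 0 * lambda1 0 ^+ k + gamma22 0 * lambda2 0 ^+ k)
    (Gamma 0 0 0 * lambda1 0 ^+ k).
  rewrite addrAC subrr add0r; lra.
set g := derive1 gamma22 0 in dg *.
have ng0 : 0 < `|g| by rewrite normr_gt0.
(* The summand 1 absorbs the first-order remainder of [lambda2], which is at most [|e|] near 0. *)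
pose c := `|derive1 lambda2 0| + 1.
have c0 : 0 < c by rewrite ltr_wpDl.
have [d [dgt0 [N1 hN1]]] := unstable_growth _ _ _ _ ng0 l2gt c0.
pose B := `|Gamma 0 0 0| + 1; have B0 : 0 < B by rewrite ltr_wpDl.
(* The midpoint of [lambda1 0] and 1 bounds [|lambda1 e|] near 0, and it is positive even when
   [lambda1 0] is 0, so it can be inverted. *)
pose r := (1 + lambda1 0) / 2.
have r0 : 0 < r by rewrite /r; lra.
have r1 : 1 < r^-1 by rewrite invf_gt1//; rewrite /r; lra.
have [N2 hN2] := @exp_unbounded R r^-1 (1 / 2) B r1 ltac:(lra).
(* None of these bounds restricts the neighbourhood in terms of [k], so a single ball serves every
   [k]. *)
have : \forall e \near (0 : R), [/\ `|Gamma e 0 0| <= B, `|lambda1 e| <= r,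
    11 / 12 * `|g| * `|e| <= `|gamma22 e|,
    `|lambda2 e - lambda2 0 - e * derive1 lambda2 0| <= 1 * `|e| &
    forall k, \tr (M_word (p e) (S k)) =
      Gamma e 0 0 * lambda1 e ^+ k + gamma22 e * lambda2 e ^+ k].
  near=> e; split; last by near: e.
  - apply: ltW; near: e; apply: derivable_norm_near => //.
    by rewrite ltrDl.
  - apply: ltW; near: e; apply: derivable_norm_near => //.
    by rewrite ger0_norm// /r; lra.
  (* A relative error of 1 / 12 yields the factor 11 / 12 expected by [unstable_growth]. *)
  - have : `|gamma22 e - gamma22 0 - e * g| <= 1 / 12 * `|g| * `|e|.
      near: e; apply: derivable_first_order => //.
      by rewrite mulr_gt0.
    rewrite g0 subr0 => h.
    have := ler_normB (gamma22 e) (gamma22 e - e * g).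
    rewrite opprB addrC subrK normrM; lra.
  - by near: e; apply: derivable_first_order.
move=> /nbhs_ballP[d' /= d'0 hd'].
(* Halving [d'] turns the closed condition on [e] into membership in the open ball. *)
exists (Num.min d (d' / 2)), (maxn N1 N2)%:Z; split.
  by rewrite lt_min dgt0 divr_gt0.
move=> k e; rewrite lez_nat geq_max => /andP[kN1 kN2] elo.
rewrite le_min => /andP[ed ed'] z _ _ _ /norm_trace_stable.
have e0 : 0 < e.
  apply: lt_le_trans elo; rewrite mulr_gt0 ?divr_gt0// invr_gt0 exprn_gt0//; lra.
have /hd' [GB l1r ge l2e ->] : ball 0 d' e.
  by rewrite /ball /= sub0r normrN gtr0_norm//; lra.
apply/negP; rewrite -ltNge.
rewrite (gtr0_norm e0) in ge l2e.
have ll : lambda2 0 * (1 - c * e) <= lambda2 e.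
  have h1 : c * e <= lambda2 0 * (c * e) by rewrite ler_peMl ?mulr_ge0 ?ltW.
  have h2 : - (e * derive1 lambda2 0) <= e * `|derive1 lambda2 0|.
    by rewrite -mulrN ler_pM2l// -normrN ler_norm.
  have := ler_norm (- (lambda2 e - lambda2 0 - e * derive1 lambda2 0)).
  rewrite normrN; move: h1; rewrite /c; lra.
have l2k : 5 / 2 <= `|gamma22 e * lambda2 e ^+ k|.
  apply: le_trans (hN1 k e _ kN1 elo ed ll) _; rewrite normrM.
  apply: le_trans (ler_wpM2l _ (ler_norm _)) _; first by rewrite !mulr_ge0// ltW.
  by rewrite ler_wpM2r.
have l1k : `|Gamma e 0 0 * lambda1 e ^+ k| < 1 / 2.
  have rk : B * r ^+ k < 1 / 2.
    have := hN2 k kN2; rewrite exprVn ltr_pdivlMr ?exprn_gt0//.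
  apply: le_lt_trans rk; rewrite normrM normrX ler_pM// lerXn2r// nnegrE//.
  exact: ltW.
(* The trace exceeds 5 / 2 - 1 / 2 = 2 in absolute value, strictly because the [lambda1] term is
   strictly below 1 / 2. *)
have := ler_normB (Gamma e 0 0 * lambda1 e ^+ k + gamma22 e * lambda2 e ^+ k)
  (Gamma e 0 0 * lambda1 e ^+ k).
rewrite addrAC subrr add0r; lra.
Unshelve. all: by end_near. Qed.
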